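(* Let $1\le M\le N$ and let $\vec w=(w_1,\dots,w_N)$ be a weight vector with positive entries summing to $1$, sorted in non-decreasing order. Let $G_1,\dots,G_M$ be the partition of $[N]$ used by the algorithm Representative Electoral College and let $p_m=\sum_{i\in G_m}w_i$ for $m\in[M]$. Then the sortition algorithm Representative Electoral College is $\lambda$-decentralized with $$\lambda=\min_{m\in[M]}\ \min_{i\in G_m}\frac{w_i}{p_m}.$$
   Context: Setting: there are $N$ participants, indexed by $[N]=\{1,\dots,N\}$, with positive weights $w_i$, $\sum_i w_i=1$. A sortition algorithm outputs a random committee $\mathcal{M}\subseteq[N]$ of size $M$ and unnormalized weights $g_n$; the voting power is $g(n;\mathcal{M})=g_n/\sum_{m\in\mathcal{M}}g_m$ for $n\in\mathcal{M}$ and $g(n;\mathcal{M})=0$ for $n\notin\mathcal{M}$. For $\lambda>0$, the algorithm is $\lambda$-decentralized if for every committee realization $\mathcal{M}$ (every committee that can be output), $\max_{m\in\mathcal{M}}\frac{g(m;\mathcal{M})}{w_m}\le\frac1\lambda$. Algorithm Representative Electoral College (input $\vec w$, $M$): (1) sort participants so that $w_1\le\dots\le w_N$; (2) split $[N]$ into $M$ consecutive groups: $G_1$ consists of the first $N_1$ participants, $G_2$ of the next $N_2$, and so on up to $G_M$, where $N_i=\lfloor N/M\rfloor+\mathbf{1}\big((N\bmod M)\ge i\big)$; (3) compute $p_m=\sum_{i\in G_m}w_i$ for $m\in[M]$; (4) select $\mathcal{M}=\{m_1,\dots,m_M\}$ randomly such that $m_i$ is drawn from $G_i$ with $\mathbb{P}(m_i=j)=\frac{w_j}{\sum_{n\in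 G_i}w_n}$ for each $j\in G_i$; (5) set $g_{m_i}=p_i$ for $i\in[M]$ and $g_m=0$ for $m\notin\mathcal{M}$. *)

(* Defs.v *)
From HB Require Import structures.
From mathcomp Require Import all_boot all_order all_algebra.
From mathcomp Require Import zify.

Set Implicit Arguments.
Unset Strict Implicit.
Unset Printing Implicit Defensive.

Import Order.TTheory GRing.Theory Num.Theory.
Local Open Scope ring_scope.

(* Participants are 'I_N and groups are 'I_M, both numbered from 0. *)

(* A randomized algorithm with finitely many outcomes [omega] of law [prob];
   [gweight A o n] is the unnormalized weight g_n in outcome o.  An outcome can
   be output when its probability is positive. *)
Record sortition (R : realFieldType) (N M : nat) := Sortition {
  omega : finType;
  prob : omega -> R;
  committee : omega -> {set 'I_N};
  gweight : omega -> 'I_N -> R;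
  prob_ge0 : forall o, 0 <= prob o;
  prob_sum1 : \sum_o prob o = 1;
  card_committee : forall o, 0 < prob o -> #|committee o| = M
}.

Definition voting_power (R : realFieldType) (N M : nat) (A : sortition R N M)
    (o : omega A) (n : 'I_N) : R :=
  if n \in committee o
  then gweight o n / \sum_(m in committee o) gweight o m else 0.

(* The default 0 of the maximum is harmless, 1 / lambda being positive. *)
Definition decentralized (R : realFieldType) (N M : nat) (w : 'I_N -> R)
    (A : sortition R N M) (lambda : R) : Prop :=
  0 < lambda /\
  forall o : omega A, 0 < prob o ->
    \big[Num.max/0]_(m in committee o) (voting_power o m / w m) <= 1 / lambda.

(* With groups numbered from 0, 1((N mod M) >= i) becomes (i < N %% M). *)
Definition group_size (N M i : nat) : nat := (N %/ M + (i < N %% M))%N.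

Definition group_start (N M i : nat) : nat :=
  (\sum_(0 <= j < i) group_size N M j)%N.

Definition group (N M : nat) (i : 'I_M) : {set 'I_N} :=
  [set n : 'I_N | (group_start N M i <= n < group_start N M i.+1)%N].

Definition group_weight (R : realFieldType) (N M : nat) (w : 'I_N -> R)
    (i : 'I_M) : R :=
  \sum_(n in group N i) w n.

(* Steps (2)-(5) of Representative Electoral College, for a weight vector [w]
   that is already sorted; [draw o i] is the participant m_i drawn from the
   i-th group.  Only the law of each m_i is prescribed, their joint law is
   arbitrary; independent draws are one instance, see
   [representative_electoral_college_independent]. *)
Definition electoral_draw (R : realFieldType) (N M : nat) (w : 'I_N -> R)
    (A : sortition R N M) (draw : omega A -> 'I_M -> 'I_N) : Prop :=
  (forall (i : 'I_M) (j : 'I_N),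
    \sum_(o | draw o i == j) prob o =
      if j \in group N i then w j / \sum_(n in group N i) w n else 0) /\
  (forall o : omega A, 0 < prob o ->
    [/\ committee o = [set draw o i | i : 'I_M],
        forall i : 'I_M, gweight o (draw o i) = group_weight w i
      & forall n : 'I_N, n \notin committee o -> gweight o n = 0]).

Definition representative_electoral_college (R : realFieldType) (N M : nat)
    (w : 'I_N -> R) (A : sortition R N M) : Prop :=
  exists draw : omega A -> 'I_M -> 'I_N, electoral_draw w draw.

(* The default 1 of the minima is harmless since w_i <= p_m for i in G_m; see
   [rec_lambda_le] and [rec_lambda_attained]. *)
Definition rec_lambda (R : realFieldType) (N M : nat) (w : 'I_N -> R) : R :=
  \big[Num.min/1]_(m < M)
    \big[Num.min/1]_(i in group N m) (w i / group_weight w m).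

Lemma group_start_mono (N M i j : nat) :
  (i <= j)%N -> (group_start N M i <= group_start N M j)%N.
Proof.
move=> ij; rewrite /group_start (@big_cat_nat _ _ _ i _ _ _ _ (leq0n i) ij) /=.
exact: leq_addr.
Qed.

Lemma group_startE (N M i : nat) :
  group_start N M i = (i * (N %/ M) + minn i (N %% M))%N.
Proof.
elim: i => [|i IH]; first by rewrite /group_start big_nil min0n.
rewrite /group_start big_nat_recr //= -/(group_start N M i) IH /group_size.
by case: (ltnP i (N %% M)); lia.
Qed.

Lemma group_start_last (N M : nat) : (0 < M)%N -> group_start N M M = N.
Proof.
move=> M0; rewrite group_startE (minn_idPr _); last exact/ltnW/ltn_pmod.
by rewrite mulnC -divn_eq.
Qed.

Lemma group_inj (N M : nat) (i j : 'I_M) (n : 'I_N) :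
  n \in group N i -> n \in group N j -> i = j.
Proof.
rewrite !inE => /andP[ai bi] /andP[aj bj]; apply/val_inj => /=.
case: (ltngtP i j) => // ij.
  by have := group_start_mono N M ij; lia.
by have := group_start_mono N M ij; lia.
Qed.

Lemma group_neq0 (N M : nat) (i : 'I_M) : (M <= N)%N -> exists n, n \in group N i.
Proof.
move=> MN; have M0 : (0 < M)%N by case: i => i /= /(leq_ltn_trans (leq0n i)).
have lt : (group_start N M i < group_start N M i.+1)%N.
  rewrite /group_start big_nat_recr //= -[X in (X < _)%N]addn0 ltn_add2l.
  by rewrite /group_size addn_gt0 divn_gt0 // MN.
have le : (group_start N M i.+1 <= N)%N.
  by rewrite -[X in (_ <= X)%N](group_start_last N M0); apply: group_start_mono.
by exists (Ordinal (leq_trans lt le)); rewrite inE /= leqnn.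
Qed.

Lemma group_weight_gt0 (R : realFieldType) (N M : nat) (w : 'I_N -> R)
    (i : 'I_M) :
  (M <= N)%N -> (forall n, 0 < w n) -> 0 < group_weight w i.
Proof.
move=> MN w0; have [n nG] := group_neq0 i MN.
rewrite /group_weight (bigD1 n) //=; apply: ltr_pwDl => //.
by apply: sumr_ge0 => k _; apply: ltW.
Qed.

Lemma rec_lambda_le (R : realFieldType) (N M : nat) (w : 'I_N -> R)
    (m : 'I_M) (i : 'I_N) :
  i \in group N m -> rec_lambda M w <= w i / group_weight w m.
Proof.
move=> iG; apply: (@le_trans _ _
  (\big[Num.min/1]_(j in group N m) (w j / group_weight w m))).
  exact: (@bigmin_le _ R _ 1 m
    (fun m => \big[Num.min/1]_(j in group N m) (w j / group_weight w m))).
exact: (@bigmin_le_cond _ R _ 1 i [in group N m]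
  (fun j => w j / group_weight w m)).
Qed.

Lemma rec_lambda_attained (R : realFieldType) (N M : nat) (w : 'I_N -> R) :
  (1 <= M)%N -> (M <= N)%N -> (forall n, 0 < w n) ->
  exists m : 'I_M, exists2 i : 'I_N,
    i \in group N m & rec_lambda M w = w i / group_weight w m.
Proof.
move=> M0 MN w0.
have le1 (m : 'I_M) i : i \in group N m -> w i / group_weight w m <= 1.
  move=> iG; rewrite ler_pdivrMr ?group_weight_gt0 // mul1r.
  rewrite /group_weight (bigD1 i) //= lerDl.
  by apply: sumr_ge0 => k _; apply: ltW.
pose m0 := Ordinal M0.
have [m _ Em] := @eq_bigmin _ R _ 1 m0 xpredT
  (fun m : 'I_M => \big[Num.min/1]_(i in group N m) (w i / group_weight w m))
  isT (fun m _ => bigmin_le_id _ _ _ _).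
exists m; have [i0 i0G] := group_neq0 m MN.
have [i iG Ei] := @eq_bigmin _ R _ 1 i0 [in group N m]
  (fun i => w i / group_weight w m) i0G (le1 m).
by exists i; rewrite // -Ei -Em.
Qed.

Lemma representative_electoral_college_independent (R : realFieldType)
    (N M : nat) (w : 'I_N -> R) :
  (M <= N)%N -> (forall n, 0 < w n) ->
  exists (A : sortition R N M) (draw : omega A -> 'I_M -> 'I_N),
    electoral_draw w draw /\
    forall s : 'I_M -> 'I_N,
      \sum_(o | [forall i, draw o i == s i]) prob o =
        \prod_i \sum_(o | draw o i == s i) prob o.
Proof.
move=> MN w0.
pose q (i : 'I_M) j := if j \in group N i then w j / group_weight w i else 0.
have q0 i j : 0 <= q i j.
  rewrite /q; case: ifP => // _.
  by apply: divr_ge0; apply/ltW; rewrite ?group_weight_gt0.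
have q1 i : \sum_j q i j = 1.
  rewrite /q -big_mkcond -mulr_suml /= divff //.
  by rewrite gt_eqF // group_weight_gt0.
pose pr (s : {ffun 'I_M -> 'I_N}) := \prod_i q i (s i).
have pr0 s : 0 <= pr s by apply: prodr_ge0.
have pr1 : \sum_s pr s = 1.
  rewrite -(bigA_distr_bigA q) big1 // => i _; exact: q1.
have prG s i : 0 < pr s -> s i \in group N i.
  rewrite lt0r => /andP[/prodf_neq0 /(_ i isT) + _].
  by rewrite /q; case: ifP; rewrite ?eqxx.
have prI s : 0 < pr s -> injective s.
  move=> s0 i j e; apply: (@group_inj N M i j (s i)); first exact: prG.
  by rewrite e; exact: prG.
have prM s : 0 < pr s -> #|[set s i | i : 'I_M]| = M.
  by move=> /prI sI; rewrite card_imset // card_ord.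
pose A := @Sortition R N M _ pr (fun s => [set s i | i : 'I_M])
  (fun s n => \sum_(i | s i == n) group_weight w i) pr0 pr1 prM.
have marg (i : 'I_M) (j : 'I_N) :
    \sum_(s : {ffun 'I_M -> 'I_N} | s i == j) pr s = q i j.
  pose F k l := if (k == i) && (l != j) then 0 else q k l.
  transitivity (\sum_(s : {ffun 'I_M -> 'I_N}) \prod_k F k (s k)).
    rewrite big_mkcond; apply: eq_bigr => s _; case: eqP => [e | /eqP ne].
      apply: eq_bigr => k _; rewrite /F; case: eqP => //= ->.
      by rewrite e eqxx.
    by rewrite (bigD1 i) //= /F eqxx ne mul0r.
  have Fk k : k != i -> \sum_l F k l = 1.
    move=> ki; rewrite -[RHS](q1 k); apply: eq_bigr => l _.
    by rewrite /F (negPf ki).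
  rewrite -(bigA_distr_bigA F) (bigD1 i) //= [X in _ * X]big1 // mulr1.
  rewrite (bigD1 j) //= big1 ?addr0; first by rewrite /F !eqxx.
  by move=> l lj; rewrite /F eqxx lj.
exists A, (fun (s : {ffun 'I_M -> 'I_N}) i => s i); split; first split=> [|s s0]; first exact: marg.
  split=> // [i | n nI] /=.
    rewrite (bigD1 i) //= big1 ?addr0 // => k /andP[/eqP/(prI _ s0)-> ].
    by rewrite eqxx.
  rewrite big1 // => i /eqP e; case/negP: nI; rewrite -e.
  exact: imset_f.
move=> s; rewrite (eq_bigr _ (fun i _ => marg i (s i))) /=.
rewrite (big_pred1 (finfun s)) => [|t /=].
  by apply: eq_bigr => i _; rewrite ffunE.
apply/forallP/eqP => [e | -> i]; last by rewrite ffunE.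
by apply/ffunP => i; rewrite ffunE; apply/eqP.
Qed.

(* Main.v *)
Require Import Defs.
From HB Require Import structures.
From mathcomp Require Import all_boot all_order all_algebra.

Set Implicit Arguments.
Unset Strict Implicit.
Unset Printing Implicit Defensive.

Import Order.TTheory GRing.Theory Num.Theory.
Local Open Scope ring_scope.

(* An outcome of positive probability forces every m_i to lie in G_i, so each
   member m_i has voting power p_i / (p_1 + ... + p_M).  The groups partition
   the participants, hence this denominator is 1, and the ratio p_i / w_(m_i) is
   the inverse of one of the terms over which the minimum lambda is taken. *)

(** Take the first boundary [group_start N M i] beyond [n], which exists because the last one is
    [N]; by minimality the preceding boundary is at most [n]. *)
Lemma group_cover (N M : nat) (n : 'I_N) :
  (0 < M)%N -> exists i : 'I_M, n \in group N i.
Proof.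
move=> M0; have exP : exists i, (n < group_start N M i)%N.
  by exists M; rewrite group_start_last.
case: (ex_minnP exP) => [[|i]] lt_n minP; first by rewrite /group_start big_nil in lt_n.
have iM : (i < M)%N by apply: minP; rewrite group_start_last.
exists (Ordinal iM); rewrite inE /= lt_n andbT leqNgt.
by apply/negP => /minP; rewrite ltnn.
Qed.

(** Double counting: by [group_cover] and [group_inj] each [w n] is counted exactly once. *)
Lemma sum_group_weight (R : realFieldType) (N M : nat) (w : 'I_N -> R) :
  (0 < M)%N -> \sum_(i < M) group_weight w i = \sum_n w n.
Proof.
move=> M0; rewrite /group_weight (exchange_big_dep predT) //=.
apply: eq_bigr => n _; have [i nGi] := group_cover n M0.
rewrite (big_pred1 i) // => j; apply/idP/eqP => [nGj | -> //].
exact: group_inj nGj nGi.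
Qed.

Lemma rec_lambda_gt0 (R : realFieldType) (N M : nat) (w : 'I_N -> R) :
  (0 < M)%N -> (M <= N)%N -> (forall n, 0 < w n) -> 0 < rec_lambda M w.
Proof.
move=> M0 MN w0; have [m [i _ ->]] := rec_lambda_attained M0 MN w0.
by rewrite divr_gt0 // group_weight_gt0.
Qed.

Section ElectoralDraw.

Variables (R : realFieldType) (N M : nat) (w : 'I_N -> R) (A : sortition R N M).
Variable draw : omega A -> 'I_M -> 'I_N.
Hypothesis drawP : electoral_draw w draw.
Variable o : omega A.
Hypothesis o_gt0 : 0 < prob o.

(** The prescribed law gives a participant outside the group probability 0, while the event of
    drawing [draw o i] contains [o] and so has probability at least [prob o]. *)
Lemma draw_in_group (i : 'I_M) : draw o i \in group N i.
Proof.
have [/(_ i (draw o i)) + _] := drawP.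
case: ifP => // _ sum0; suff: prob o <= 0 by rewrite leNgt o_gt0.
rewrite -sum0 (bigD1 o) //= lerDl.
by apply: sumr_ge0 => o' _; apply: prob_ge0.
Qed.

Lemma draw_inj : injective (draw o).
Proof.
move=> i j eq_ij; apply: group_inj (draw_in_group i) _.
by rewrite eq_ij draw_in_group.
Qed.

Lemma sum_gweight :
  \sum_(m in committee o) gweight o m = \sum_(i < M) group_weight w i.
Proof.
have [_ /(_ o o_gt0) [-> gE _]] := drawP.
(* Reindexing the committee by groups requires distinct draws. *)
rewrite big_imset /=; first by apply: eq_bigr.
by move=> i j _ _; apply: draw_inj.
Qed.

Lemma voting_power_draw (i : 'I_M) :
  voting_power o (draw o i) = group_weight w i / \sum_(j < M) group_weight w j.
Proof.
have [_ /(_ o o_gt0) [comE gE _]] := drawP.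
by rewrite /voting_power sum_gweight gE comE imset_f.
Qed.

End ElectoralDraw.

Theorem proposition4p9 (R : realFieldType) (N M : nat) (hM : (1 <= M)%N)
    (hMN : (M <= N)%N) (w : 'I_N -> R) (w_pos : forall i : 'I_N, 0 < w i)
    (w_sum : \sum_(i < N) w i = 1)
    (w_sorted : forall i j : 'I_N, (i <= j)%N -> w i <= w j)
    (A : sortition R N M) (hA : representative_electoral_college w A) :
  decentralized w A (rec_lambda M w).
Proof.
have l0 := rec_lambda_gt0 hM hMN w_pos.
split=> // o o0; have [draw drawP] := hA.
have [_ /(_ o o0) [-> _ _]] := drawP.
(* The first goal bounds the default [0] of the maximum. *)
apply: bigmax_le => [|_ /imsetP[i _ ->]]; first by rewrite divr_ge0 // ltW.
rewrite (voting_power_draw drawP o0) sum_group_weight // w_sum divr1.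
(* Inversion reverses the order on positive numbers. *)
rewrite -invf_div div1r lef_pV2 ?posrE ?divr_gt0 ?group_weight_gt0 //.
exact: rec_lambda_le (draw_in_group drawP o0 i).
Qed.
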